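(* Let $X$ be a Bishop topological group with Bishop topology $F$, and let $C$ be a subgroup of $X$. (i) $C$ is closed if and only if there is an open set $O$ in $X$ such that $O \cap C$ is inhabited and closed in $O$. (ii) $C$ is open if and only if there is an inhabited, open set $O$ in $X$ such that $O \subseteq C$.
   Context: The setting is Bishop-style constructive mathematics (BISH: intuitionistic logic, every set $X$ carries a given equality $=_X$, no countable choice). $\mathbb{F}(X)$ is the set of functions $X \to \mathbb{R}$ with pointwise equality. $\mathrm{Bic}(\mathbb{R})$ is the set of functions $\phi : \mathbb{R} \to \mathbb{R}$ that are uniformly continuous on every interval $[-n,n]$, $n \geq 1$. A Bishop space is a pair $(X,F)$, where $X$ is an inhabited set and $F \subseteq \mathbb{F}(X)$ is extensional (if $f \in F$ and $g$ is pointwise equal to $f$, then $g \in F$) such that: (BS1) all constant functions are in $F$; (BS2) $f, g \in F$ implies $f+g \in F$; (BS3) $f \in F$ and $\phi \in \mathrm{Bic}(\mathbb{R})$ imply $\phi \circ f \in F$; (BS4) if $f \in \mathbb{F}(X)$ and for every $\varepsilon > 0$ there is $g \in F$ with $|g(x) - f(x)| \leq \varepsilon$ for all $x \in X$, then $f \in F$. Then $F$ is called a Bishop topology on $X$. A Bishop morphism from $(X,F)$ to $(Y,G)$ is a function $h : X \to Y$ with $g \circ h \in F$ for every $g \in G$. The product topology $F \times G$ on $X \times Y$ is the least Bishop topology (inductively generated by the closure conditions (BS1)-(BS4) and extensionality) containing all $f \circ \pi_1$, $f \in F$, and all $g \circ \pi_2$, $g \in G$, where $\pi_1, \pi_2$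 are the projections. A Bishop topological group is a (not necessarily abelian, additively written) group $(X,+,0,-)$ with a Bishop topology $F$ on $X$ such that $+ : X \times X \to X$ is a Bishop morphism from $(X \times X, F \times F)$ to $(X,F)$ and $- : X \to X$ is a Bishop morphism from $(X,F)$ to $(X,F)$. For $f \in F$ let $U(f) := \{x \in X \mid f(x) > 0\}$. A subset $O \subseteq X$ is open if for every $x \in O$ there is $f \in F$ with $f(x) > 0$ and $U(f) \subseteq O$. For $C \subseteq X$, the closure $\overline{C}$ consists of all $x \in X$ such that for every $f \in F$, if $f(x) > 0$ then there is $c \in C$ with $f(c) > 0$; $C$ is closed if $\overline{C} \subseteq C$. ''$O \cap C$ is closed in $O$'' means: for every $z \in O$, if $z \in \overline{O \cap C}$ then $z \in O \cap C$. Inhabited means having an element. *)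

(* Defs.v *)
From Stdlib Require Export ZArith QArith.
From Stdlib Require Export RelationClasses Morphisms Setoid.
From Stdlib Require Export ConstructiveCauchyReals ConstructiveCauchyAbs.

Set Implicit Arguments.
Unset Strict Implicit.

(** Constructive reading, without axioms: Bishop sets are setoids, existence
    is the [exists] of [Prop] (so no choice principle is implicit), and the
    reals are the Cauchy reals [CReal].  As [<] of [CReal_scope] lives in
    [Set], the [Prop]-valued [CRealLtProp] is used throughout. *)

Declare Scope bishop_scope.
Delimit Scope bishop_scope with bishop.
Open Scope bishop_scope.

Notation "x <R y" := (CRealLtProp x y) (at level 70) : bishop_scope.

(** * Sets with equality, functions and subsets *)

Record bset : Type := Bset {
  carrier :> Type;
  eqv : carrier -> carrier -> Prop;
  eqv_equiv : Equivalence eqv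
}.
Arguments eqv {b} _ _.
#[export] Existing Instance eqv_equiv.

Notation "x =s y" := (eqv x y) (at level 70) : bishop_scope.

Record bfun (X Y : bset) : Type := Bfun {
  ap :> X -> Y;
  ap_proper : Proper (eqv ==> eqv) ap
}.
#[export] Existing Instance ap_proper.

Record subset (X : bset) : Type := Subset {
  mem :> X -> Prop;
  mem_proper : Proper (eqv ==> iff) mem
}.
#[export] Existing Instance mem_proper.

Definition real : bset := Bset CRealEq_rel.

Definition comp (X Y Z : bset) (g : bfun Y Z) (f : bfun X Y) : bfun X Z.
Proof.
  refine (@Bfun X Z (fun x => g (f x)) _).
  intros x y e. now rewrite e.
Defined.

Definition const (X Y : bset) (c : Y) : bfun X Y.
Proof.
  refine (@Bfun X Y (fun _ => c) _).
  intros x y _. reflexivity.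
Defined.

Definition fplus (X : bset) (f g : bfun X real) : bfun X real.
Proof.
  refine (@Bfun X real (fun x => (f x + g x)%CReal) _).
  intros x y e. simpl.
  pose proof (ap_proper f e) as ef. pose proof (ap_proper g e) as eg.
  simpl in ef, eg. now rewrite ef, eg.
Defined.

Definition bprod (X Y : bset) : bset.
Proof.
  refine (@Bset (X * Y) (fun p q => fst p =s fst q /\ snd p =s snd q) _).
  split.
  - intros p. split; reflexivity.
  - intros p q [e1 e2]. split; now symmetry.
  - intros p q r [e1 e2] [e3 e4]. split; etransitivity; eassumption.
Defined.

Definition proj1 (X Y : bset) : bfun (bprod X Y) X.
Proof.
  refine (@Bfun (bprod X Y) X (fun p => fst p) _).
  intros p q [e _]. exact e.
Defined.

Definition proj2 (X Y : bset) : bfun (bprod X Y) Y.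
Proof.
  refine (@Bfun (bprod X Y) Y (fun p => snd p) _).
  intros p q [_ e]. exact e.
Defined.

Definition subset_incl (X : bset) (A B : subset X) : Prop :=
  forall x, A x -> B x.

Definition subset_inhab (X : bset) (A : subset X) : Prop := exists x, A x.

Definition subset_inter (X : bset) (A B : subset X) : subset X.
Proof.
  refine (@Subset X (fun x => A x /\ B x) _).
  intros x y e. now rewrite e.
Defined.

(** * Bishop spaces *)

Definition Bic (phi : bfun real real) : Prop :=
  forall (n : positive) (eps : CReal), inject_Q 0 <R eps ->
  exists delta : CReal, inject_Q 0 <R delta /\
    forall x y : CReal,
      (- inject_Z (Zpos n) <= x <= inject_Z (Zpos n))%CReal ->
      (- inject_Z (Zpos n) <= y <= inject_Z (Zpos n))%CReal ->
      (CReal_abs (x - y) <= delta)%CReal ->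
      (CReal_abs (phi x - phi y) <= eps)%CReal.

Record is_bishop_topology (X : bset) (F : bfun X real -> Prop) : Prop := {
  top_ext : forall f g : bfun X real, F f -> (forall x, f x =s g x) -> F g;
  top_const : forall a : real, F (const X a);
  top_plus : forall f g, F f -> F g -> F (fplus f g);
  top_comp : forall f phi, F f -> Bic phi -> F (comp phi f);
  top_lim : forall f : bfun X real,
    (forall eps : CReal, inject_Q 0 <R eps ->
       exists g : bfun X real,
         F g /\ forall x, (CReal_abs (g x - f x) <= eps)%CReal) ->
    F f
}.

Record bishop_space : Type := BishopSpace {
  space :> bset;
  space_inhab : inhabited space;
  top : bfun space real -> Prop;
  top_axioms : is_bishop_topology top
}.

Definition is_morphism (A B : bishop_space) (h : bfun A B) : Prop :=
  forall g : bfun B real, top g -> top (comp g h).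

(** The least Bishop topology containing [F0]; see [generated_topology] and
    [generated_least]. *)
Inductive generated (X : bset) (F0 : bfun X real -> Prop) :
  bfun X real -> Prop :=
| gen_base : forall f, F0 f -> generated F0 f
| gen_ext : forall f g : bfun X real,
    generated F0 f -> (forall x, f x =s g x) -> generated F0 g
| gen_const : forall a : real, generated F0 (const X a)
| gen_plus : forall f g,
    generated F0 f -> generated F0 g -> generated F0 (fplus f g)
| gen_comp : forall f phi,
    generated F0 f -> Bic phi -> generated F0 (comp phi f)
| gen_lim : forall f : bfun X real,
    (forall eps : CReal, inject_Q 0 <R eps ->
       exists g : bfun X real,
         generated F0 g /\ forall x, (CReal_abs (g x - f x) <= eps)%CReal) ->
    generated F0 f.

Lemma generated_topology (X : bset) (F0 : bfun X real -> Prop) :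
  is_bishop_topology (generated F0).
Proof.
  split; [exact (@gen_ext X F0) | exact (@gen_const X F0)
         | exact (@gen_plus X F0) | exact (@gen_comp X F0)
         | exact (@gen_lim X F0)].
Qed.

Lemma generated_least (X : bset) (F0 G : bfun X real -> Prop) :
  is_bishop_topology G -> (forall f, F0 f -> G f) ->
  forall f, generated F0 f -> G f.
Proof.
  intros HG H0. fix IH 2. intros f Hf.
  destruct Hf as [f Hf | f g Hf e | a | f g Hf Hg | f phi Hf Hphi | f Hf].
  - exact (H0 f Hf).
  - exact (top_ext HG (IH f Hf) e).
  - exact (top_const HG a).
  - exact (top_plus HG (IH f Hf) (IH g Hg)).
  - exact (top_comp HG (IH f Hf) Hphi).
  - apply (top_lim HG). intros eps Heps.
    destruct (Hf eps Heps) as [g [Hg Hfg]].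
    exists g. split; [exact (IH g Hg) | exact Hfg].
Qed.

Inductive product_base (A B : bishop_space) : bfun (bprod A B) real -> Prop :=
| product_base1 : forall f : bfun A real,
    top f -> product_base (comp f (proj1 A B))
| product_base2 : forall g : bfun B real,
    top g -> product_base (comp g (proj2 A B)).

Definition product_space (A B : bishop_space) : bishop_space.
Proof.
  refine (@BishopSpace (bprod A B) _ (generated (@product_base A B))
            (generated_topology _)).
  destruct (space_inhab A) as [a], (space_inhab B) as [b].
  exact (inhabits (a, b)).
Defined.

(** * Open and closed subsets *)

Definition cozero (X : bset) (f : bfun X real) : subset X.
Proof.
  refine (@Subset X (fun x => inject_Q 0 <R f x) _).
  intros x y e. pose proof (ap_proper f e) as ef. simpl in ef.
  now rewrite ef.
Defined.

Definition is_open (X : bishop_space) (O : subset X) : Prop :=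
  forall x, O x ->
  exists f : bfun X real, top f /\ cozero f x /\ subset_incl (cozero f) O.

Definition closure (X : bishop_space) (C : subset X) : subset X.
Proof.
  refine (@Subset X (fun x => forall f : bfun X real, top f ->
            inject_Q 0 <R f x -> exists c, C c /\ inject_Q 0 <R f c) _).
  intros x y e. split; intros H f Hf Hp; apply (H f Hf);
    pose proof (ap_proper f e) as ef; simpl in ef.
  - now rewrite ef.
  - now rewrite <- ef.
Defined.

Definition is_closed (X : bishop_space) (C : subset X) : Prop :=
  subset_incl (closure C) C.

Definition is_closed_in (X : bishop_space) (A O : subset X) : Prop :=
  forall z, O z -> closure A z -> A z.

(** * Bishop topological groups *)

Record bishop_group : Type := BishopGroup {
  gspace :> bishop_space;
  gadd : bfun (product_space gspace gspace) gspace;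
  gzero : gspace;
  gopp : bfun gspace gspace;
  gaddA : forall x y z, gadd (x, gadd (y, z)) =s gadd (gadd (x, y), z);
  gadd0l : forall x, gadd (gzero, x) =s x;
  gadd0r : forall x, gadd (x, gzero) =s x;
  gaddNl : forall x, gadd (gopp x, x) =s gzero;
  gaddNr : forall x, gadd (x, gopp x) =s gzero;
  gadd_morphism : is_morphism gadd;
  gopp_morphism : is_morphism gopp
}.

Record is_subgroup (X : bishop_group) (C : subset X) : Prop := {
  sub_zero : C (gzero X);
  sub_add : forall x y, C x -> C y -> C (gadd X (x, y));
  sub_opp : forall x, C x -> C (gopp X x)
}.

(* Main.v *)
Require Import Defs.
From Stdlib Require Import ConstructiveCauchyRealsMult.

Set Implicit Arguments.
Unset Strict Implicit.

(** The classical argument for topological groups carries over because it only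
    moves neighbourhoods around by group operations, and each such move is a
    Bishop morphism: by the universal property of the product topology
    ([pairing_morphism]), sums of morphisms into [X] are again morphisms
    ([gsum_morphism]), so translations are morphisms, and for [f] in the
    topology [y |-> f (c - y + x)] is in the topology too.

    For the hard half of (i), let [c] be in [O] and [C], let [f] witness that
    [O] is open at [c], and let [x] be in the closure of [C].  The function
    [y |-> f (c - y + x)] is positive at [y = x], hence at some [y] in [C]; so
    [z := c - y + x] lies in [O].  As [x' |-> c - y + x'] preserves [C] and
    maps [x] to [z], the point [z] is in the closure of [C], and even in the
    closure of the intersection of [O] and [C], since closure points can be
    localised to a cozero neighbourhood ([closure_inter_cozero]).  Closedness in
    [O] puts [z] in [C], hence also [x = y - c + z].  Localisation needs two
    positivity conditions to be expressed by a single element of the topology,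
    for which twice the minimum serves ([cozero_inter]).  The converse takes
    for [O] the whole of [X].

    For (ii), if [f (o) > 0] and [f] is positive only on [C], then
    [y |-> f (y - x + o)] shows that [C] is open at any of its points [x]: the
    coset of [C] on which it can be positive is [C] itself.  The converse takes
    [O] to be [C]. *)

(** * Intersections of cozero sets *)

Local Open Scope CReal_scope.

Definition abs_fun : bfun real real := @Bfun real real CReal_abs _.

Definition opp_fun : bfun real real := @Bfun real real CReal_opp _.

Lemma abs_Bic : Bic abs_fun.
Proof.
  intros n eps Heps. exists eps. split; [exact Heps |].
  intros x y _ _ H. exact (CReal_le_trans _ _ _ (CReal_abs_triang_inv2 x y) H).
Qed.

Lemma opp_Bic : Bic opp_fun.
Proof.
  intros n eps Heps. exists eps. split; [exact Heps |].
  intros x y _ _ H. simpl.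
  setoid_replace (- x - - y) with (- (x - y)) by ring.
  now rewrite CReal_abs_opp.
Qed.

(** Halving is avoided by cotransitivity: [0 < a + a] gives [0 < a] or
    [a < a + a]. *)
Lemma double_pos (a : CReal) : 0 < a + a -> 0 < a.
Proof.
  intros H. destruct (CRealLt_dec _ _ a H) as [Ha | Ha]; [exact Ha |].
  apply (CReal_plus_lt_reg_l a).
  setoid_replace (a + 0) with a by ring. exact Ha.
Qed.

Lemma pos_double (a : CReal) : 0 < a -> 0 < a + a.
Proof.
  intros H. apply (CReal_lt_trans _ _ _ H).
  apply (CReal_plus_lt_compat_l a) in H.
  now rewrite CReal_plus_0_r in H.
Qed.

Lemma pos_min (a b : CReal) :
  0 <R a + b + - CReal_abs (a + - b) <-> 0 <R a /\ 0 <R b.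
Proof.
  split.
  - intros H%CRealLtEpsilon.
    assert (L : CReal_abs (a - b) < a + b).
    { apply (CReal_plus_lt_reg_l (- CReal_abs (a - b))).
      setoid_replace (- CReal_abs (a - b) + CReal_abs (a - b)) with 0 by ring.
      rewrite CReal_plus_comm. exact H. }
    apply CReal_abs_lt in L. destruct L as [L1 L2].
    split; apply CRealLtForget, double_pos.
    + apply (CReal_plus_lt_reg_l (b - a)).
      setoid_replace (b - a + 0) with (- (a - b)) by ring.
      setoid_replace (b - a + (a + a)) with (a + b) by ring. exact L2.
    + apply (CReal_plus_lt_reg_l (a - b)).
      setoid_replace (a - b + 0) with (a - b) by ring.
      setoid_replace (a - b + (b + b)) with (a + b) by ring. exact L1.
  - intros [Ha%CRealLtEpsilon Hb%CRealLtEpsilon]. apply CRealLtForget.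
    assert (L : CReal_abs (a - b) < a + b).
    { apply Rabs_def1.
      - apply (CReal_plus_lt_reg_l (b - a)).
        setoid_replace (b - a + (a - b)) with 0 by ring.
        setoid_replace (b - a + (a + b)) with (b + b) by ring.
        now apply pos_double.
      - apply (CReal_plus_lt_reg_l (a - b)).
        setoid_replace (a - b + - (a - b)) with 0 by ring.
        setoid_replace (a - b + (a + b)) with (a + a) by ring.
        now apply pos_double. }
    change (a + - b) with (a - b).
    apply (CReal_plus_lt_reg_l (CReal_abs (a - b))).
    setoid_replace (CReal_abs (a - b) + 0) with (CReal_abs (a - b)) by ring.
    setoid_replace (CReal_abs (a - b) + (a + b + - CReal_abs (a - b)))
      with (a + b) by ring.
    exact L.
Qed.

(** The minimum lies in the topology although only sums and post-composition
    with [Bic] functions of one variable are given, because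
    [2 min (a, b) = a + b - |a - b|]. *)
Lemma cozero_inter (A : bishop_space) (f g : bfun A real) :
  top f -> top g ->
  exists k : bfun A real,
    top k /\ forall x, cozero k x <-> cozero f x /\ cozero g x.
Proof.
  intros Hf Hg. pose proof (top_axioms A) as T.
  exists (fplus (fplus f g)
    (comp opp_fun (comp abs_fun (fplus f (comp opp_fun g))))).
  split.
  - apply (top_plus T); [now apply (top_plus T) |].
    apply (top_comp T); [| exact opp_Bic].
    apply (top_comp T); [| exact abs_Bic].
    apply (top_plus T); [exact Hf |].
    apply (top_comp T); [exact Hg | exact opp_Bic].
  - intros x. apply pos_min.
Qed.

(** Being in a closure is tested on basic neighbourhoods, so a closure point
    lying in an open set is approached from within that set. *)
Lemma closure_inter_cozero (A : bishop_space) (C O : subset A)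
    (f : bfun A real) (x : A) :
  top f -> subset_incl (cozero f) O -> cozero f x ->
  closure C x -> closure (subset_inter O C) x.
Proof.
  intros Hf HO Hfx HC h Hh Hhx.
  destruct (cozero_inter Hf Hh) as [k [Hk E]].
  destruct (HC k Hk) as [c [Cc Hc]]; [now apply E |].
  apply E in Hc as [Hfc Hhc].
  exists c. split; [split; [now apply HO | exact Cc] | exact Hhc].
Qed.

Lemma closure_mono (A : bishop_space) (C D : subset A) :
  subset_incl C D -> subset_incl (closure C) (closure D).
Proof.
  intros H x Hx f Hf Hp. destruct (Hx f Hf Hp) as [c [Cc Hc]].
  exists c. split; [now apply H | exact Hc].
Qed.

Lemma closure_image (A B : bishop_space) (h : bfun A B)
    (C : subset A) (D : subset B) (x : A) :
  is_morphism h -> (forall y, C y -> D (h y)) ->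
  closure C x -> closure D (h x).
Proof.
  intros Hh HCD Hx f Hf Hp.
  destruct (Hx (comp f h) (Hh f Hf) Hp) as [c [Cc Hc]].
  exists (h c). split; [now apply HCD | exact Hc].
Qed.

(** * Morphisms into a topological group *)

Definition id_fun (A : bset) : bfun A A :=
  @Bfun A A (fun x => x) (fun x y e => e).

Lemma id_morphism (A : bishop_space) :
  is_morphism (A := A) (B := A) (id_fun A).
Proof.
  intros f Hf. apply (top_ext (top_axioms A) Hf). intros x. reflexivity.
Qed.

Lemma const_morphism (A B : bishop_space) (b : B) :
  is_morphism (A := A) (const A b).
Proof.
  intros f Hf. apply (top_ext (top_axioms A) (top_const (top_axioms A) (f b))).
  intros x. reflexivity.
Qed.

Definition pairing (A B D : bset) (h : bfun A B) (k : bfun A D) :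
  bfun A (bprod B D).
Proof.
  refine (@Bfun A (bprod B D) (fun x => (h x, k x)) _).
  intros x y e. split; simpl; now apply ap_proper.
Defined.

(** The functions on the product that pull back along the pairing to elements
    of the topology form a Bishop topology, which contains the generators. *)
Lemma pairing_morphism (A B D : bishop_space) (h : bfun A B) (k : bfun A D) :
  is_morphism h -> is_morphism k ->
  is_morphism (A := A) (B := product_space B D) (pairing h k).
Proof.
  intros Hh Hk g Hg. pose proof (top_axioms A) as T.
  refine (generated_least
    (G := fun u : bfun (bprod B D) real => top (comp u (pairing h k)))
    _ _ Hg).
  - split.
    + intros u v Hu E. apply (top_ext T Hu). intros x. apply E.
    + intros a. apply (top_ext T (top_const T a)). intros x. reflexivity.
    + intros u v Hu Hv. apply (top_ext T (top_plus T Hu Hv)).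
      intros x. reflexivity.
    + intros u phi Hu Hphi. apply (top_ext T (top_comp T Hu Hphi)).
      intros x. reflexivity.
    + intros u Hu. apply (top_lim T). intros eps Heps.
      destruct (Hu eps Heps) as [v [Hv E]].
      exists (comp v (pairing h k)). split; [exact Hv |]. intros x. apply E.
  - intros u [f Hf | f Hf].
    + apply (top_ext T (Hh f Hf)). intros x. reflexivity.
    + apply (top_ext T (Hk f Hf)). intros x. reflexivity.
Qed.

Lemma comp_morphism (A B D : bishop_space) (k : bfun B D) (h : bfun A B) :
  is_morphism k -> is_morphism h -> is_morphism (A := A) (B := D) (comp k h).
Proof.
  intros Hk Hh g Hg. apply (top_ext (top_axioms A) (Hh _ (Hk g Hg))).
  intros x. reflexivity.
Qed.

Lemma gsum_morphism (A : bishop_space) (X : bishop_group) (h k : bfun A X) :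
  is_morphism h -> is_morphism k ->
  is_morphism (A := A) (B := X) (comp (gadd X) (pairing h k)).
Proof.
  intros Hh Hk.
  exact (comp_morphism (@gadd_morphism X) (pairing_morphism Hh Hk)).
Qed.

Local Notation "x +g y" := (gadd _ (x, y)) (at level 50, left associativity).
Local Notation "-g x" := (gopp _ x) (at level 35, right associativity).

Definition ltrans (X : bishop_group) (a : X) : bfun X X :=
  comp (gadd X) (pairing (const X a) (id_fun X)).

Definition rtrans (X : bishop_group) (b : X) : bfun X X :=
  comp (gadd X) (pairing (id_fun X) (const X b)).

Lemma ltrans_morphism (X : bishop_group) (a : X) : is_morphism (ltrans a).
Proof. apply gsum_morphism; [apply const_morphism | apply id_morphism]. Qed.

Lemma rtrans_morphism (X : bishop_group) (b : X) : is_morphism (rtrans b).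
Proof. apply gsum_morphism; [apply id_morphism | apply const_morphism]. Qed.

(** * Group identities *)

#[local] Instance gadd_pair_proper (X : bishop_group) :
  Proper (eqv ==> eqv ==> eqv) (fun x y : X => x +g y).
Proof.
  intros x x' e y y' e'. apply (ap_proper (gadd X)). now split.
Qed.

Lemma gaddKN (X : bishop_group) (x y : X) : (x +g -g y) +g y =s x.
Proof.
  rewrite <- gaddA. etransitivity; [| apply gadd0r].
  apply gadd_pair_proper; [reflexivity | apply gaddNl].
Qed.

Lemma gaddNK (X : bishop_group) (x y : X) : (x +g y) +g -g y =s x.
Proof.
  rewrite <- gaddA. etransitivity; [| apply gadd0r].
  apply gadd_pair_proper; [reflexivity | apply gaddNr].
Qed.

Lemma gNaddK (X : bishop_group) (x y : X) : -g x +g (x +g y) =s y.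
Proof.
  rewrite gaddA. etransitivity; [| apply gadd0l].
  apply gadd_pair_proper; [apply gaddNl | reflexivity].
Qed.

Lemma gaddKr (X : bishop_group) (x y : X) : x +g (-g x +g y) =s y.
Proof.
  rewrite gaddA. etransitivity; [| apply gadd0l].
  apply gadd_pair_proper; [apply gaddNr | reflexivity].
Qed.

Lemma subgroup_cancel_l (X : bishop_group) (C : subset X) (x y : X) :
  is_subgroup C -> C x -> C (x +g y) -> C y.
Proof.
  intros hC Hx Hxy. rewrite <- (gNaddK x y).
  exact (sub_add hC (sub_opp hC Hx) Hxy).
Qed.

Lemma subgroup_cancel_r (X : bishop_group) (C : subset X) (x y : X) :
  is_subgroup C -> C y -> C (x +g y) -> C x.
Proof.
  intros hC Hy Hxy. rewrite <- (gaddNK x y).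
  exact (sub_add hC Hxy (sub_opp hC Hy)).
Qed.

(** * Closed and open subgroups *)

Definition full (X : bset) : subset X.
Proof. refine (@Subset X (fun _ => True) _). intros x y _. tauto. Defined.

Lemma full_open (A : bishop_space) : is_open (full A).
Proof.
  intros x _. exists (const A (1 : real)). split; [| split].
  - apply (top_const (top_axioms A)).
  - apply CRealLtForget, CRealLt_0_1.
  - now intros y.
Qed.

(** A closure point [x] of [C] is carried by a translation preserving [C] into
    the open set where the local hypothesis applies. *)
Lemma closed_of_locally_closed (X : bishop_group) (C O : subset X) :
  is_subgroup C -> is_open O -> subset_inhab (subset_inter O C) ->
  is_closed_in (subset_inter O C) O -> is_closed C.
Proof.
  intros hC HO [c [Oc Cc]] Hcl x Hx.
  destruct (HO c Oc) as [f [Hf [fc fO]]].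
  (* [y |-> c - y + x] sends [x] to [c], where [f] is positive. *)
  assert (Hm : is_morphism (comp (rtrans x) (comp (ltrans c) (gopp X)))).
  { apply comp_morphism; [apply rtrans_morphism |].
    apply comp_morphism; [apply ltrans_morphism | apply gopp_morphism]. }
  destruct (Hx _ (Hm f Hf)) as [y [Cy fy]].
  { change (cozero f ((c +g -g x) +g x)). now rewrite gaddKN. }
  change (cozero f ((c +g -g y) +g x)) in fy.
  assert (Ca : C (c +g -g y)) by exact (sub_add hC Cc (sub_opp hC Cy)).
  assert (Cz : closure C ((c +g -g y) +g x)).
  { apply (closure_image (C := C) (ltrans_morphism (c +g -g y)));
      [| exact Hx].
    intros w Cw. exact (sub_add hC Ca Cw). }
  apply (subgroup_cancel_l hC Ca).
  now destruct (Hcl _ (fO _ fy) (closure_inter_cozero Hf fO fy Cz)).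
Qed.

(** The right translation carrying [x] to [o] is by an element of [C], so it
    pulls a neighbourhood of [o] in [C] back to one of [x] in [C]. *)
Lemma open_of_open_subset (X : bishop_group) (C O : subset X) :
  is_subgroup C -> subset_inhab O -> is_open O -> subset_incl O C ->
  is_open C.
Proof.
  intros hC [o Oo] HO HOC x Cx.
  destruct (HO o Oo) as [f [Hf [fo fO]]].
  exists (comp f (rtrans (-g x +g o))). split; [| split].
  - exact (@rtrans_morphism X _ f Hf).
  - change (cozero f (x +g (-g x +g o))). now rewrite gaddKr.
  - intros y Hy. change (cozero f (y +g (-g x +g o))) in Hy.
    apply (subgroup_cancel_r (y := -g x +g o) hC).
    + exact (sub_add hC (sub_opp hC Cx) (HOC _ Oo)).
    + exact (HOC _ (fO _ Hy)).
Qed.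

Theorem theorem5p9 (X : bishop_group) (C : subset X) (hC : is_subgroup C) :
  (is_closed C <->
     exists O : subset X,
       is_open O /\ subset_inhab (subset_inter O C) /\
       is_closed_in (subset_inter O C) O)
  /\
  (is_open C <->
     exists O : subset X,
       subset_inhab O /\ is_open O /\ subset_incl O C).
Proof.
  split; split.
  - intros HC. exists (full X). split; [apply full_open | split].
    + exists (gzero X). split; [exact I | exact (sub_zero hC)].
    + intros z _ Hz. split; [exact I |]. apply HC.
      refine (closure_mono _ Hz). now intros y [_ Cy].
  - intros [O [HO [Hi Hcl]]]. exact (closed_of_locally_closed hC HO Hi Hcl).
  - intros HC. exists C. split; [| split].
    + exists (gzero X). exact (sub_zero hC).
    + exact HC.
    + now intros y.
  - intros [O [Hi [HO HOC]]]. exact (open_of_open_subset hC Hi HO HOC).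
Qed.
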